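(* Let $\mathcal H$ be a complex Hilbert space, let $F:\bigcup_{n\ge1}\mathcal D(\mathcal H^{\otimes n})\to\mathbb R$ and $f:\mathbb R\to\mathbb R$ be maps, and assume: (i) for every integer $n\ge 1$, $F$ is convex on $\mathcal D(\mathcal H^{\otimes n})$; (ii) $F$ is sub-additive on pure product states: $F(|\psi\rangle\langle\psi|\otimes|\phi\rangle\langle\phi|)\le F(|\psi\rangle\langle\psi|)+F(|\phi\rangle\langle\phi|)$; (iii) $f$ is convex and $f(0)=0$; (iv) for every integer $n\ge1$ there is a subset $\Gamma_n\subset\mathcal D(\mathcal H^{\otimes n})$ on which $F(\hat\rho)\le f(n)$. Let $1\le k\le n$ be integers. If $\hat\rho\in\mathcal D(\mathcal H^{\otimes n})$ is $k$-separable over $\Gamma=\bigcup_m\Gamma_m$, then $$F(\hat\rho)\le\left\lfloor\frac nk\right\rfloor f(k)+f\!\left(n-\left\lfloor\frac nk\right\rfloor k\right)\le\frac nk f(k).$$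
   Context: $\mathcal D(\mathcal K)$ denotes the set of mixed states (positive trace-one operators) on a Hilbert space $\mathcal K$; pure states are unit vectors. A pure state $|\psi\rangle\in\mathcal H^{\otimes n}$ is $k$-separable over $\Gamma$ if (after permuting the $n$ systems) it can be written $|\psi\rangle=|\phi_1\rangle\otimes\cdots\otimes|\phi_l\rangle$, where each $|\phi_i\rangle\in\mathcal H^{\otimes r_i}$ is a pure state with $r_i\le k$ and $|\phi_i\rangle\langle\phi_i|\in\Gamma_{r_i}$. A mixed state $\hat\rho\in\mathcal D(\mathcal H^{\otimes n})$ is $k$-separable over $\Gamma$ if it is a mixture $\hat\rho=\sum_ip_i|\psi_i\rangle\langle\psi_i|$ (with $p_i\ge0$, $\sum_ip_i=1$) of pure states $|\psi_i\rangle$ that are $k$-separable over $\Gamma$.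
   Formalization: Sub-additivity (ii) is assumed for products across any splitting of the systems, not only consecutive factors; the permutation in k-separability keeps the order of systems inside each factor; mixtures are finite. Without these the claim fails for non-symmetric F or countable mixtures. *)

(* Defs.v *)
From HB Require Import structures.
From mathcomp Require Import all_boot all_order all_algebra.
From mathcomp Require Import complex.
From mathcomp Require Import all_classical all_reals all_analysis.

Set Implicit Arguments.
Unset Strict Implicit.
Unset Printing Implicit Defensive.
Import Order.TTheory GRing.Theory Num.Theory.
Import numFieldNormedType.Exports.
Local Open Scope classical_set_scope.
Local Open Scope ring_scope.
Local Open Scope complex_scope.

(* The form [hdot] is linear in its first argument and conjugate-linear in its
   second one, so the Dirac bracket <x|y> is [hdot y x]. *)
Record hilbertType (R : realType) := Hilbert {
  hcarrier :> completeNormedModType R[i];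
  hdot : {dot hcarrier for (@Num.conj R[i])};
  hnormE : forall x : hcarrier, `|x| ^+ 2 = hdot x x }.

Section Hilbert.
Variables (R : realType) (V : hilbertType R).

Definition linear_span (A : set V) : set V :=
  [set v | exists (m : nat) (a : 'I_m -> R[i]) (w : 'I_m -> V),
     (forall i, A (w i)) /\ v = \sum_(i < m) a i *: w i].

Definition total_set (A : set V) : Prop := closure (linear_span A) = setT.

Definition orthonormal_basis (E : set V) : Prop :=
  [/\ forall e, E e -> hdot V e e = 1,
      forall e e', E e -> E e' -> e <> e' -> hdot V e e' = 0 &
      total_set E].

(* The trace of a positive operator does not depend on the basis. *)
Definition trace_one (rho : V -> V) : Prop :=
  forall E : set V, orthonormal_basis E ->
    (\esum_(e in E) (complex.Re (hdot V (rho e) e))%:E = 1)%E.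

(* In the order of R[i], [0 <= z] says that z is real and nonnegative. *)
Definition mixed_state : set (V -> V) :=
  [set rho | [/\ linear rho, continuous rho,
                 forall v, 0 <= hdot V (rho v) v & trace_one rho]].

Definition unit_vector (psi : V) : Prop := hdot V psi psi = 1.

(* The operator |psi><psi|. *)
Definition proj_on (psi : V) : V -> V := fun v => hdot V v psi *: psi.

Definition convex_on_states (F : (V -> V) -> R) : Prop :=
  forall (t : R) (rho sigma : V -> V), 0 <= t <= 1 ->
    mixed_state rho -> mixed_state sigma ->
    F (fun v => t%:C *: rho v + (1 - t)%:C *: sigma v)
      <= t * F rho + (1 - t) * F sigma.

End Hilbert.

(* A model of the Hilbert space tensor power H^{(x) n}: a Hilbert space in which
   the elementary tensors x_0 (x) ... (x) x_{n-1} are multilinear, have the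
   inner products of tensors, and span a dense subspace.  These properties
   determine the space up to a unique unitary map that preserves elementary
   tensors. *)
Record tensor_power (R : realType) (H : hilbertType R) (n : nat) :=
  TensorPower {
  tspace :> hilbertType R;
  tens : ('I_n -> H) -> tspace;
  tens_linear : forall (x : 'I_n -> H) (i : 'I_n),
    linear (fun u : H => tens (fun j => if j == i then u else x j));
  tens_dot : forall x y : 'I_n -> H,
    hdot tspace (tens x) (tens y) = \prod_(i < n) hdot H (x i) (y i);
  tens_total : total_set (range tens) }.

(* The n systems are split into l groups, the j-th of them consisting of the
   systems [e j 0 < e j 1 < ... < e j (r j - 1)].  The groups need not be made
   of consecutive systems: listing them one after the other is the permutation
   of the n systems that brings the factors of a product next to each other. *)
Definition grouping (n l : nat) (r : 'I_l -> nat)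
    (e : forall j, 'I_(r j) -> 'I_n) : Prop :=
  bijective (fun p : {j : 'I_l & 'I_(r j)} => e (tag p) (tagged p)) /\
  (forall j (a b : 'I_(r j)), (a < b)%N -> (e j a < e j b)%N).

Section Separability.
Variables (R : realType) (H : hilbertType R).
Variable T : forall n, tensor_power H n.

(* psi is the product of the vectors phi j, where phi j is a vector of the
   systems of the j-th group.  As elementary tensors are total, psi is
   determined by its inner products with them, and these are the products of
   the inner products taken in each group. *)
Definition is_tensor_product (n l : nat) (r : 'I_l -> nat)
    (e : forall j, 'I_(r j) -> 'I_n)
    (phi : forall j, T (r j)) (psi : T n) : Prop :=
  forall x : 'I_n -> H,
    hdot (T n) psi (tens (T n) x) =
    \prod_(j < l) hdot (T (r j)) (phi j) (tens (T (r j)) (fun a => x (e j a))).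

(* |psi1><psi1| (x) |psi2><psi2| is the projection on psi1 (x) psi2. *)
Definition subadditive_on_pure_products
    (F : forall n, (T n -> T n) -> R) : Prop :=
  forall (n : nat) (r : 'I_2 -> nat) (e : forall j, 'I_(r j) -> 'I_n)
         (phi : forall j, T (r j)) (psi : T n),
    (forall j, (0 < r j)%N) -> grouping e ->
    (forall j, unit_vector (phi j)) ->
    is_tensor_product e phi psi ->
    F n (proj_on psi)
      <= F (r 0) (proj_on (phi 0)) + F (r 1) (proj_on (phi 1)).

Variable Gam : forall n, set (T n -> T n).

Definition k_separable_pure (k n : nat) (psi : T n) : Prop :=
  unit_vector psi /\
  exists (l : nat) (r : 'I_l -> nat) (e : forall j, 'I_(r j) -> 'I_n)
         (phi : forall j, T (r j)),
    [/\ grouping e, is_tensor_product e phi psi &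
        forall j, [/\ (0 < r j)%N, (r j <= k)%N, unit_vector (phi j) &
                      Gam (proj_on (phi j))]].

(* Only finite mixtures: a convex function need not satisfy Jensen's inequality
   for countable ones when H is infinite-dimensional. *)
Definition k_separable (k n : nat) (rho : T n -> T n) : Prop :=
  exists (m : nat) (p : 'I_m -> R) (psi : 'I_m -> T n),
    [/\ forall i, 0 <= p i, \sum_(i < m) p i = 1,
        forall i, k_separable_pure k (psi i) &
        rho = fun v => \sum_(i < m) (p i)%:C *: proj_on (psi i) v].

End Separability.

(* Main.v *)
Require Import Defs.
From mathcomp Require Import all_boot all_order all_algebra ring lra zify.
From mathcomp Require Import complex.
From mathcomp Require Import all_classical all_reals all_analysis.
Import Order.TTheory GRing.Theory Num.Theory.
Set Implicit Arguments.
Unset Strict Implicit.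
Unset Printing Implicit Defensive.
Local Open Scope classical_set_scope.
Local Open Scope ring_scope.

(* By convexity of F it is enough to bound F on a product of pure states with
   blocks of sizes r_j <= k.  Sub-additivity, used one block at a time, bounds
   F there by the sum of the f (r_j); at each step the product of the remaining
   blocks has to be produced as a vector of their joint tensor power, which is
   where completeness enters.  Finally, since f is convex with f 0 = 0, moving
   two block sizes apart with their sum fixed never decreases f (a) + f (b), so
   the sum of the f (r_j) is largest when all blocks but one have size k. *)

(** * Dot products *)

Section DotAlgebra.
Variables (C : numClosedFieldType) (U : lmodType C).
Variable d : {dot U for (@Num.conj C)}.

Lemma dotDl (x y z : U) : d (x + y) z = d x z + d y z.
Proof. exact: linearDl. Qed.

Lemma dotDr (x y z : U) : d z (x + y) = d z x + d z y.
Proof. exact: linearDr. Qed.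

Lemma dotBl (x y z : U) : d (x - y) z = d x z - d y z.
Proof. exact: linearBl. Qed.

Lemma dotBr (x y z : U) : d z (x - y) = d z x - d z y.
Proof. exact: linearBr. Qed.

Lemma dotZl (c : C) (x y : U) : d (c *: x) y = c * d x y.
Proof. exact: linearZl_LR. Qed.

Lemma dotZr (c : C) (x y : U) : d x (c *: y) = c^* * d x y.
Proof. exact: linearZr_LR. Qed.

Lemma dot_conj (x y : U) : d x y = (d y x)^*.
Proof. by rewrite hermC expr0 mul1r. Qed.

Lemma dot_normDd (x y : U) : d x y = 0 -> d (x + y) (x + y) = d x x + d y y.
Proof. exact: hnormDd. Qed.

Lemma dot_suml (I : Type) (r : seq I) (P : pred I) (u : I -> U) (z : U) :
  d (\sum_(i <- r | P i) u i) z = \sum_(i <- r | P i) d (u i) z.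
Proof. exact: linear_sumlz. Qed.

Lemma dot_sumr (I : Type) (r : seq I) (P : pred I) (u : I -> U) (z : U) :
  d z (\sum_(i <- r | P i) u i) = \sum_(i <- r | P i) d z (u i).
Proof. exact: linear_sumr. Qed.

(** Since [z] is orthogonal to every [e] in [s], [d z z] reduces to [d z x]; the result is the exact
    defect in Bessel's inequality. *)
Lemma orthonormal_residue (s : seq U) (x : U) :
  uniq s -> (forall e, e \in s -> d e e = 1) ->
  (forall e e', e \in s -> e' \in s -> e <> e' -> d e e' = 0) ->
  let z := x - \sum_(e <- s) d x e *: e in
  (forall e, e \in s -> d z e = 0) /\
  d z z = d x x - \sum_(e <- s) d x e * (d x e)^*.
Proof.
move=> us s1 s0 z.
have zs e : e \in s -> d z e = 0.
  move=> es; rewrite /z dotBl dot_suml (bigD1_seq e)//= dotZl s1// mulr1 big_seq_cond.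
  rewrite big1 ?addr0 ?subrr// => e' /andP[e's /eqP e'e].
  by rewrite dotZl (s0 e' e)// mulr0.
split => //; rewrite {2}/z dotBr dot_sumr big_seq big1 ?subr0.
  rewrite /z dotBl dot_suml; congr (_ - _); apply: eq_bigr => e _.
  by rewrite dotZl (dot_conj e).
by move=> e es; rewrite dotZr zs// mulr0.
Qed.

End DotAlgebra.

Import numFieldNormedType.Exports.

(** * Continuity of inner products and limits of sequences *)

Section DotLimits.
Variables (C : numClosedFieldType) (V : normedModType C).
Variable d : {dot V for (@Num.conj C)}.
Hypothesis dE : forall x : V, `|x| ^+ 2 = d x x.

Lemma dot_normD (c : C) (x y : V) :
  `|x + c *: y| ^+ 2 = d x x + c^*%R * d x y + c * d y x + c * c^*%R * d y y.
Proof. by rewrite dE !dotDl !dotDr !dotZl !dotZr; ring. Qed.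

(** The inner product is recovered from norms alone, so its continuity follows from that of the
    norm. *)
Lemma dot_polarization (x y : V) :
  d x y = 4^-1 * (`|x + 1 *: y| ^+ 2 - `|x + -1 *: y| ^+ 2
            + 'i * (`|x + 'i *: y| ^+ 2 - `|x + (- 'i) *: y| ^+ 2)).
Proof.
rewrite !dot_normD.
have Hi := @sqrCi C.
rewrite !rmorphN /= !rmorph1.
have -> : ('i : C)^*%R = - 'i by apply: conjCi.
have -> : (d x x + 1 * d x y + 1 * d y x + 1 * 1 * d y y -
  (d x x + - 1 * d x y + -1 * d y x + -1 * - 1 * d y y) +
  'i * (d x x + - 'i * d x y + 'i * d y x + 'i * - 'i * d y y -
   (d x x + - - 'i * d x y + - 'i * d y x + - 'i * - - 'i * d y y)))
  = 2 * (1 - 'i ^+2) * d x y + 2 * (1 + 'i^+2) * d y x by ring.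
rewrite Hi subrr mulr0 mul0r addr0 opprK mulrA; have -> : 2 * (1 + 1) = 4 :> C by ring.
by rewrite mulVf ?mul1r// pnatr_eq0.
Qed.

Lemma cvg_dot (T : Type) (F : set_system T) {FF : ProperFilter F}
  (u v : T -> V) (a b : V) :
  u x @[x --> F] --> a -> v x @[x --> F] --> b ->
  (d (u x) (v x) : C^o) @[x --> F] --> (d a b : C^o).
Proof.
move=> ua vb.
have sq c : ((`|u x + c *: v x| ^+ 2 : C^o) @[x --> F] --> (`|a + c *: b| ^+ 2 : C^o)).
  have h : (`|u x + c *: v x| : C^o) @[x --> F] --> (`|a + c *: b| : C^o).
    by apply: cvg_norm; apply: cvgD => //; exact: cvgZr.
  by under eq_fun do rewrite expr2; rewrite expr2; exact: cvgM.
under eq_fun do rewrite dot_polarization.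
rewrite dot_polarization.
apply: cvgMl_tmp; apply: cvgD; first by apply: cvgB.
by apply: cvgMl_tmp; apply: cvgB.
Qed.

End DotLimits.

(** This is how identities checked on finite combinations reach all vectors: both sides converge,
    and limits are unique. *)
Lemma dot_cvg_eq (C : numClosedFieldType) (V W : normedModType C)
    (dV : {dot V for (@Num.conj C)}) (dW : {dot W for (@Num.conj C)}) :
  (forall x : V, `|x| ^+ 2 = dV x x) -> (forall x : W, `|x| ^+ 2 = dW x x) ->
  forall (u u' : nat -> V) (a a' : V) (w w' : nat -> W) (b b' : W) (g : C),
  u n @[n --> \oo] --> a -> u' n @[n --> \oo] --> a' ->
  w n @[n --> \oo] --> b -> w' n @[n --> \oo] --> b' ->
  (forall n, dW (w n) (w' n) = dV (u n) (u' n) * g) ->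
  dW b b' = dV a a' * g.
Proof.
move=> dVE dWE u u' a a' w w' b b' g ua u'a' wb w'b' E.
have lW : (dW (w n) (w' n) : C^o) @[n --> \oo] --> (dW b b' : C^o) by exact: cvg_dot.
have lV : (dV (u n) (u' n) : C^o) @[n --> \oo] --> (dV a a' : C^o) by exact: cvg_dot.
have lV' : (dV (u n) (u' n) * g : C^o) @[n --> \oo] --> (dV a a' * g : C^o).
  by apply: cvgMr_tmp; exact: lV.
have lW' : (dW (w n) (w' n) : C^o) @[n --> \oo] --> (dV a a' * g : C^o).
  by under eq_fun do rewrite E.
exact: (norm_cvg_unique lW lW').
Qed.

Lemma closure_seq (R : realType) (V : hilbertType R) (A : set V) (a : V) : closure A a ->
  exists u : nat -> V, (forall n, A (u n)) /\ u n @[n --> \oo] --> a.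
Proof.
move=> Aa.
have H (n : nat) : exists v, A v /\ `|a - v| < n.+1%:R^-1.
  have [v [Av /=]] := Aa _ (@nbhsx_ballx _ _ a n.+1%:R^-1 ltac:(by rewrite invr_gt0 ltr0n)).
  by rewrite -ball_normE /= => h; exists v.
have [u Hu] := choice H; exists u; split => [n|]; first by case: (Hu n).
apply/cvgrPdist_lt => e e0.
(* A positive [e] of [R[i]] is real, so [1/(n+1)] can be compared with its real part. *)
have re0 : 0 < complex.Re e by case: e e0 => x y; rewrite ltcE /= => /andP[].
have [N _ HN] := near_infty_natSinv_lt (PosNum re0).
exists N => // n Nn /=.
apply: lt_trans (Hu n).2 _.
case: e e0 re0 HN => x y; rewrite ltcE /= => /andP[/eqP -> x0] re0 HN.
have := HN n Nn => /=; rewrite -(ltcR (n.+1%:R^-1)) fmorphV rmorph_nat.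
by [].
Qed.

(** * Extension by density and products of vectors *)

Section extension.
Variables (R : realType) (A C : hilbertType R) (X Y : Type).
Variables (tA : X -> A) (u : X -> Y -> C) (g : Y -> Y -> R[i]).
Hypothesis tA_total : total_set (range tA).
Hypothesis g_ge0 : forall y, 0 <= g y y.
Hypothesis dot_u : forall x y x' y',
  hdot C (u x y) (u x' y') = hdot A (tA x) (tA x') * g y y'.

(* Each a is the limit of combinations of the vectors tA x; the same
   combinations of the u x y form a Cauchy sequence, whose limit is U a y. *)
Lemma isometric_extension : exists U : A -> Y -> C,
  (forall a y a' y', hdot C (U a y) (U a' y') = hdot A a a' * g y y') /\
  (forall x y, U (tA x) y = u x y).
Proof.
pose K := {m : nat & ('I_m -> R[i]) * ('I_m -> X)}%type.
pose ev (k : K) : A := \sum_(i < tag k) (tagged k).1 i *: tA ((tagged k).2 i).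
pose lf (k : K) (y : Y) : C := \sum_(i < tag k) (tagged k).1 i *: u ((tagged k).2 i) y.
have dot_lf k y k' y' : hdot C (lf k y) (lf k' y') = hdot A (ev k) (ev k') * g y y'.
  rewrite /lf /ev !dot_suml mulr_suml; apply: eq_bigr => i _.
  rewrite !dot_sumr mulr_suml; apply: eq_bigr => j _.
  by rewrite !dotZl !dotZr dot_u !mulrA.
(* For fixed [y], passing from [ev] to [lf] is an isometry up to the factor [sqrtC (g y y)], so
   convergence of [ev] along a sequence makes [lf] Cauchy. *)
have norm_lf k k' y : `|lf k y - lf k' y| = `|ev k - ev k'| * sqrtC (g y y).
  apply/eqP; rewrite -(@eqrXn2 _ 2)// ?mulr_ge0 ?sqrtC_ge0//.
  rewrite exprMn sqrtCK !hnormE !dotBl !dotBr !dot_lf; apply/eqP; ring.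
have : forall a : A, exists s : nat -> K, ev (s n) @[n --> \oo] --> a.
  move=> a; have : closure (linear_span (range tA)) a by rewrite tA_total.
  move=> /closure_seq [v [Hv va]].
  have : forall n, exists k : K, ev k = v n.
    move=> n; have [m [c [w [Hw ->]]]] := Hv n.
    have /choice[x Hx] : forall i, exists x, tA x = w i.
      by move=> i; have [x _ <-] := Hw i; exists x.
    exists (Tagged (fun m => ('I_m -> R[i]) * ('I_m -> X))%type (c, x)).
    by apply: eq_bigr => i _; rewrite Hx.
  by move=> /choice[s Hs]; exists s; under eq_fun do rewrite Hs.
move=> /choice[s Hs].
have cv a y : cvg (lf (s a n) y @[n --> \oo]).
  apply/cauchy_cvgP; apply/cauchy_exP => e e0.
  (* Adding [1] keeps the divisor positive when [g y y = 0]. *)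
  set c := sqrtC (g y y); have c0 : 0 < c + 1 by rewrite ltr_wpDl ?sqrtC_ge0.
  have e'0 : 0 < e / 2 / (c + 1) by rewrite !divr_gt0.
  have /cvgrPdist_lt /(_ _ e'0)[N _ HN] := Hs a.
  exists (lf (s a N) y); exists N => // n Nn; rewrite /= -ball_normE /= norm_lf.
  have h : `|ev (s a N) - ev (s a n)| <= e / (c + 1).
    rewrite (_ : e / (c + 1) = e / 2 / (c + 1) + e / 2 / (c + 1)); last first.
      by rewrite -mulrDl -splitr.
    rewrite (le_trans (ler_distD a _ _))// lerD// ltW//; last exact: HN.
    by rewrite distrC; apply: HN => /=.
  apply: (le_lt_trans (ler_wpM2r _ h)); first by rewrite sqrtC_ge0.
  by rewrite mulrAC ltr_pdivrMr// ltr_pM2l// ltrDl.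
pose U a y := lim (lf (s a n) y @[n --> \oo]).
have U_dot a y a' y' : hdot C (U a y) (U a' y') = hdot A a a' * g y y'.
  apply: (dot_cvg_eq (@hnormE R A) (@hnormE R C)
    (Hs a) (Hs a') (cv a y) (cv a' y')) => n.
  exact: dot_lf.
exists U; split => // x y.
(* The sequence chosen for [tA x] need not be constant, so [U (tA x) y = u x y] is shown by
   expanding the squared norm of the difference; this identity supplies the mixed terms. *)
have Uu a x' y' : hdot C (U a y) (u x' y') = hdot A a (tA x') * g y y'.
  apply: (dot_cvg_eq (u' := fun=> tA x') (w' := fun=> u x' y') (@hnormE R A) (@hnormE R C)
    (Hs a) (cvg_cst _) (cv a y) (cvg_cst _)) => n.
  by rewrite /lf /ev !dot_suml mulr_suml; apply: eq_bigr => i _; rewrite !dotZl dot_u mulrA.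
apply/eqP; rewrite -subr_eq0 -normr_eq0 -sqrf_eq0 hnormE !dotBl !dotBr.
by rewrite U_dot Uu (dot_conj _ (u x y) (U _ _)) Uu -dot_u -dot_conj !subrr.
Qed.
End extension.

(** The vector [v - w] is orthogonal to [A], hence to the finite combinations of [A] that converge
    to [v - w] itself. *)
Lemma total_dot_inj (R : realType) (V : hilbertType R) (A : set V) (v w : V) :
  total_set A -> (forall a, A a -> hdot V v a = hdot V w a) -> v = w.
Proof.
move=> Atot vw; have : closure (linear_span A) (v - w) by rewrite Atot.
move=> /closure_seq [s [As sl]].
have : hdot V (v - w) (v - w) = hdot V (v - w) (v - w) * 0.
  apply: (dot_cvg_eq (u := s) (u' := s) (w := fun=> v - w)
    (@hnormE R V) (@hnormE R V) sl sl (cvg_cst _) sl) => n.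
  have [m [c [x [Ax ->]]]] := As n.
  rewrite mulr0 dot_sumr big1// => i _.
  by rewrite dotZr dotBl vw// subrr mulr0.
rewrite mulr0 => /eqP; rewrite -hnormE sqrf_eq0 normr_eq0 subr_eq0.
by move=> /eqP.
Qed.

(** Supplies products of arbitrary vectors, while [tensor_power] only gives elementary tensors. *)
Lemma hilbert_product (R : realType) (A B C : hilbertType R) (X Y : Type)
    (tA : X -> A) (tB : Y -> B) (tC : X -> Y -> C) :
  total_set (range tA) -> total_set (range tB) ->
  (forall x y x' y', hdot C (tC x y) (tC x' y') =
     hdot A (tA x) (tA x') * hdot B (tB y) (tB y')) ->
  exists P : A -> B -> C,
    (forall a b a' b', hdot C (P a b) (P a' b') = hdot A a a' * hdot B b b') /\
    (forall x y, P (tA x) (tB y) = tC x y).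
Proof.
move=> totA totB dotC.
have dge0 (V : hilbertType R) (v : V) : 0 <= hdot V v v.
  by rewrite -hnormE exprn_ge0.
(* The first factor is extended from X to A with Y as parameter, and then the
   second one from Y to B with A as parameter. *)
have [U [dotU UE]] := isometric_extension totA (fun y => dge0 B (tB y)) dotC.
have dotU' y a y' a' : hdot C (U a y) (U a' y') = hdot B (tB y) (tB y') * hdot A a a'.
  by rewrite dotU mulrC.
have [P [dotP PE]] := isometric_extension totB (dge0 A) dotU'.
exists (fun a b => P b a); split => [a b a' b'|x y]; first by rewrite dotP mulrC.
by rewrite PE UE.
Qed.

(** * Groups of systems *)

Definition sum_fun (n a b : nat) (ea : 'I_a -> 'I_n) (eb : 'I_b -> 'I_n)
  (s : 'I_a + 'I_b) : 'I_n := match s with inl i => ea i | inr i => eb i end.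

(** [enum B] filters the increasing list of all ordinals, so it is increasing, as the listing of a
    group has to be. *)
Lemma enum_val_mono (n : nat) (B : {set 'I_n}) (i j : 'I_#|B|) :
  (enum_val i < enum_val j)%N = (i < j)%N.
Proof.
have x0 : 'I_n := enum_val i.
have srt : sorted ltn (map val (enum B)).
  have : sorted ltn (map val (enum 'I_n)) by rewrite val_enum_ord iota_ltn_sorted.
  rewrite !sorted_map /enum_mem; set E := Finite.enum _ => srtE.
  apply: sorted_filter; first by move=> x y z; exact: ltn_trans.
  exact: srtE.
have lt (k l : 'I_#|B|) : (k < l)%N -> (enum_val k < enum_val l)%N.
  move=> kl; rewrite !(enum_val_nth x0).
  rewrite -!(nth_map x0 0%N val) -?cardE //.
  by apply: (sorted_ltn_nth ltn_trans) => //; rewrite inE size_map -cardE.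
case: (ltngtP i j) => [/lt -> //|/lt/ltnW|/val_inj ->]; last by rewrite ltnn.
by rewrite ltnNge => ->.
Qed.

Lemma inj_surj_bijective (A B : Type) (f : A -> B) :
  injective f -> (forall b, exists a, f a = b) -> bijective f.
Proof.
move=> fI /choice[g gK]; exists g => // a; apply: fI; exact: gK.
Qed.

(* e' lists the systems outside the first group, and e'' the other groups as
   groups of those. *)
Lemma rest_grouping (n l : nat) (r : 'I_l.+2 -> nat) (e : forall j, 'I_(r j) -> 'I_n) :
  (forall j, (0 < r j)%N) -> grouping e ->
  exists (m : nat) (e' : 'I_m -> 'I_n)
    (e'' : forall j : 'I_l.+1, 'I_(r (lift ord0 j)) -> 'I_m),
  [/\ (0 < m)%N, bijective (sum_fun (e ord0) e'),
      forall i j : 'I_m, (i < j)%N -> (e' i < e' j)%N,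
      grouping e'' &
      forall j a, e' (e'' j a) = e (lift ord0 j) a].
Proof.
move=> r0 [[h fK hK] inc].
have eI j a j' a' : e j a = e j' a' -> Tagged (fun j => 'I_(r j)) a = Tagged (fun j => 'I_(r j)) a'.
  by move=> E; apply: (can_inj fK).
pose B := ~: [set e ord0 a | a : 'I_(r ord0)].
have eB j a : e (lift ord0 j) a \in B.
  rewrite inE; apply/negP => /imsetP[b _ /eI /(congr1 tag)] /=.
  by move=> /eqP; rewrite eq_sym (negPf (neq_lift _ _)).
(* The second group is nonempty and so provides a member of [B], which [enum_rank_in] requires and
   which gives [0 < m]. *)
have x0B := eB ord0 (Ordinal (r0 _)).
pose rk := enum_rank_in x0B.
have rkK x : x \in B -> enum_val (rk x) = x by move=> xB; exact: enum_rankK_in.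
exists #|B|, enum_val, (fun j a => rk (e (lift ord0 j) a)); split.
- by apply/card_gt0P; eexists; exact: x0B.
- apply: inj_surj_bijective.
    move=> [a|i] [b|j] /=.
    + by move=> /eI/eqP; rewrite eq_Tagged => /eqP /= ->.
    + move=> E; have := enum_valP j; rewrite -E inE => /negP[].
      by apply/imsetP; exists a.
    + move=> E; have := enum_valP i; rewrite E inE => /negP[].
      by apply/imsetP; exists b.
    + by move=> /enum_val_inj ->.
  move=> x; have [xB|] := boolP (x \in B); first by exists (inr (rk x)); rewrite /= rkK.
  by rewrite inE negbK => /imsetP[a _ ->]; exists (inl a).
- by move=> i j; rewrite enum_val_mono.
- split.
    apply: inj_surj_bijective.
      move=> [j a] [j' a'] /= /(congr1 enum_val); rewrite !rkK// => /eI E.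
      have jj' : j = j' by apply: (@lift_inj _ ord0); exact: (congr1 tag E).
      subst j'; move: E => /eqP; rewrite eq_Tagged => /eqP /= -> //.
    move=> i; have [x xE] : exists x, (fun p : {j & 'I_(r j)} => e (tag p) (tagged p)) x = enum_val i.
      by exists (h (enum_val i)); rewrite hK.
    case: x xE => j a /=; case: (unliftP ord0 j) a => [j' -> | ->] a E.
      by exists (Tagged (fun j : 'I_l.+1 => 'I_(r (lift ord0 j))) a); apply: enum_val_inj => /=; rewrite rkK.
    have := enum_valP i; rewrite -E inE => /negP[].
    by apply/imsetP; exists a.
  by move=> j a b ab; rewrite -enum_val_mono !rkK//; exact: inc.
- by move=> j a; rewrite rkK.
Qed.

(** * Products of pure states *)

Section products.
Variables (R : realType) (H : hilbertType R) (T : forall n, tensor_power H n).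

(** Elementary tensors over the [n] systems split along [ea] and [eb], and their inner products
    multiply, so [hilbert_product] applies. *)
Lemma tensor_product_vector (n a b : nat) (ea : 'I_a -> 'I_n) (eb : 'I_b -> 'I_n)
    (phi : T a) (chi : T b) : bijective (sum_fun ea eb) ->
  exists psi : T n, hdot (T n) psi psi = hdot (T a) phi phi * hdot (T b) chi chi /\
    forall x, hdot (T n) psi (tens (T n) x) =
      hdot (T a) phi (tens (T a) (x \o ea)) * hdot (T b) chi (tens (T b) (x \o eb)).
Proof.
move=> bij; have [h fK hK] := bij.
pose t x y : T n := tens (T n) (fun i => match h i with inl c => x c | inr c => y c end).
have tE x : t (x \o ea) (x \o eb) = tens (T n) x.
  congr tens; apply/funext => i; rewrite -[in RHS](hK i).
  by case: (h i).
have dot_t x y x' y' : hdot (T n) (t x y) (t x' y') =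
    hdot (T a) (tens (T a) x) (tens (T a) x') * hdot (T b) (tens (T b) y) (tens (T b) y').
  rewrite !tens_dot (reindex (sum_fun ea eb)) /=; last exact: onW_bij.
  rewrite big_sumType /=; congr (_ * _); apply: eq_bigr => i _.
    by have /= -> := fK (inl i).
  by have /= -> := fK (inr i).
have [P [dotP PE]] := hilbert_product (@tens_total _ _ _ (T a)) (@tens_total _ _ _ (T b)) dot_t.
by exists (P phi chi); split => [|x]; rewrite ?dotP// -tE -PE dotP.
Qed.

(** An increasing bijection is the identity once [r = n] is substituted, so [phi] itself is the
    vector. This is the case of a single group. *)
Lemma tensor_product_cast (r n : nat) (e : 'I_r -> 'I_n)
    (F : forall n, (T n -> T n) -> R) (phi : T r) :
  bijective e -> (forall a b : 'I_r, (a < b)%N -> (e a < e b)%N) ->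
  exists psi : T n, [/\ hdot (T n) psi psi = hdot (T r) phi phi,
    F n (proj_on psi) = F r (proj_on phi) &
    forall x, hdot (T n) psi (tens (T n) x) = hdot (T r) phi (tens (T r) (x \o e))].
Proof.
move=> bije ince; have rn : r = n by have := bij_eq_card bije; rewrite !card_ord.
case: n / rn e bije ince => e [d eK dK] ince.
(* An increasing self-map never falls below the identity; applied to [e] and to its inverse [d],
   this gives [e i = i]. *)
have incge (g : 'I_r -> 'I_r) : (forall a b : 'I_r, (a < b)%N -> (g a < g b)%N) ->
    forall i : 'I_r, (i <= g i)%N.
  move=> incg [j]; elim: j => // j IH jr.
  have jr' : (j < r)%N by exact: ltn_trans jr.
  by apply: leq_ltn_trans (IH jr') _; apply: incg.
have incd (a b : 'I_r) : (a < b)%N -> (d a < d b)%N.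
  move=> ab; rewrite ltnNge leq_eqVlt; apply/negP => /orP[/eqP/val_inj/(can_inj dK) E|].
    by rewrite E ltnn in ab.
  by move=> /ince; rewrite !dK ltnNge (ltnW ab).
have eE i : e i = i.
  apply/val_inj/eqP; rewrite eqn_leq (incge e ince) andbT.
  have := incge d incd i; rewrite leq_eqVlt => /orP[/eqP/val_inj E|/ince].
    by rewrite {1}E dK.
  by rewrite dK => /ltnW.
exists phi; split => // x; congr (hdot _ _ (tens _ _)).
by apply/funext => i /=; rewrite eE.
Qed.

Section subadditivity.
Variable F : forall n, (T n -> T n) -> R.
Hypothesis F_subadd : subadditive_on_pure_products F.

(** [F_subadd] speaks of dependent families over ['I_2]; here the two blocks are given separately,
    as the induction on blocks produces them. *)
Lemma subadditive_two (n a b : nat) (ea : 'I_a -> 'I_n) (eb : 'I_b -> 'I_n)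
    (phi : T a) (chi : T b) (psi : T n) :
  (0 < a)%N -> (0 < b)%N ->
  (forall i j : 'I_a, (i < j)%N -> (ea i < ea j)%N) ->
  (forall i j : 'I_b, (i < j)%N -> (eb i < eb j)%N) ->
  bijective (sum_fun ea eb) -> unit_vector phi -> unit_vector chi ->
  (forall x, hdot (T n) psi (tens (T n) x) =
      hdot (T a) phi (tens (T a) (x \o ea)) * hdot (T b) chi (tens (T b) (x \o eb))) ->
  F (proj_on psi) <= F (proj_on phi) + F (proj_on chi).
Proof.
move=> a0 b0 inca incb [h fK hK] uphi uchi psiE.
(* All types depend on [j] through the boolean [c j], so a case split on it settles positivity,
   monotonicity and unit norm for both blocks. *)
pose c (j : 'I_2) := if j == ord0 then true else false.
pose sel (P : nat -> Type) (x : P a) (y : P b) (j : bool) : P (if j then a else b) :=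
  if j return P (if j then a else b) then x else y.
pose r (j : 'I_2) := if c j then a else b.
pose e (j : 'I_2) : 'I_(r j) -> 'I_n := sel (fun m => 'I_m -> 'I_n) ea eb (c j).
pose v (j : 'I_2) : T (r j) := sel (fun m => T m : Type) phi chi (c j).
have := @F_subadd n r e v psi; apply.
- by move=> j; rewrite /r; case: (c j).
- split.
    pose k (s : 'I_a + 'I_b) : {j : 'I_2 & 'I_(r j)} := match s with
      | inl i => Tagged (fun j => 'I_(r j)) (i : 'I_(r ord0))
      | inr i => Tagged (fun j => 'I_(r j)) (i : 'I_(r (lift ord0 ord0))) end.
    have kf s : e (tag (k s)) (tagged (k s)) = sum_fun ea eb s by case: s.
    have kS p : exists s, k s = p.
      case: p => j; case: (unliftP ord0 j) => [j' -> | ->] i; last by exists (inl i).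
      by rewrite (ord1 j') in i *; exists (inr i).
    exists (k \o h) => [p|i] /=; last by rewrite kf hK.
    by have [s <-] := kS p; rewrite kf fK.
  by move=> j; rewrite /e /r; case: (c j).
- by move=> j; rewrite /v /r; case: (c j).
- by move=> x; rewrite psiE big_ord_recl big_ord1.
Qed.

(** Induction on the number of groups: the product [chi] of all groups but the first lives over the
    remaining [m] systems, and [psi] is the product of [phi ord0] with it. The vector is
    constructed, not given, because the induction has to produce [chi]. *)
Lemma subadditive_blocks (l n : nat) (r : 'I_l.+1 -> nat)
    (e : forall j, 'I_(r j) -> 'I_n) (phi : forall j, T (r j)) :
  (forall j, (0 < r j)%N) -> grouping e -> (forall j, unit_vector (phi j)) ->
  exists psi : T n, [/\ unit_vector psi, is_tensor_product e phi psi &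
    F (proj_on psi) <= \sum_j F (proj_on (phi j))].
Proof.
elim: l n r e phi => [|l IH] n r e phi r0 ge uphi.
  have [[h fK hK] inc] := ge.
  have bije : bijective (e ord0).
    apply: inj_surj_bijective.
      move=> a b E.
      have /eqP : Tagged (fun j => 'I_(r j)) a = Tagged (fun j => 'I_(r j)) b by exact: (can_inj fK).
      by rewrite eq_Tagged => /eqP.
    move=> i; have := hK i; case: (h i) => j; rewrite (ord1 j) => a /= <-.
    by exists a.
  have [psi [n1 Fpsi psiE]] := tensor_product_cast F (phi ord0) bije (inc ord0).
  exists psi; split; first by rewrite /unit_vector n1; exact: uphi.
    by move=> x; rewrite psiE big_ord1.
  by rewrite big_ord1 Fpsi.
have [m [e' [e'' [m0 bij ince' ge'' e'e]]]] := rest_grouping r0 ge.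
have [chi [uchi chiE Fchi]] := IH _ _ e'' (fun j => phi (lift ord0 j))
  (fun j => r0 _) ge'' (fun j => uphi _).
have [psi [n1 psiE]] := tensor_product_vector (phi ord0) chi bij.
exists psi; split.
- by rewrite /unit_vector n1 uphi uchi mulr1.
- move=> x; rewrite psiE big_ord_recl chiE; congr (_ * _).
  apply: eq_bigr => j _; congr (hdot _ _ (tens _ _)).
  by apply/funext => a /=; rewrite e'e.
rewrite big_ord_recl; apply: le_trans (lerD (lexx _) Fchi).
apply: subadditive_two psiE => //; exact: ge.2.
Qed.

(** Inner products with elementary tensors determine a vector, so [psi] is the one built in
    [subadditive_blocks]. *)
Lemma subadditive_product (l n : nat) (r : 'I_l.+1 -> nat)
    (e : forall j, 'I_(r j) -> 'I_n) (phi : forall j, T (r j)) (psi : T n) :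
  (forall j, (0 < r j)%N) -> grouping e -> (forall j, unit_vector (phi j)) ->
  is_tensor_product e phi psi ->
  F (proj_on psi) <= \sum_j F (proj_on (phi j)).
Proof.
move=> r0 ge uphi psiE.
have [psi' [_ psi'E]] := subadditive_blocks r0 ge uphi.
suff -> : psi' = psi by [].
apply: (total_dot_inj (@tens_total _ _ _ (T n))) => _ [x _ <-].
by rewrite psi'E psiE.
Qed.
End subadditivity.
End products.

(** * Mixtures of pure states *)

Lemma continuous_dotl_scale (C : numClosedFieldType) (V : normedModType C)
    (d : {dot V for (@Num.conj C)}) (p : V) :
  (forall x : V, `|x| ^+ 2 = d x x) -> continuous (fun v : V => d v p *: p).
Proof.
move=> dE x; apply: (@cvgZr_tmp C).
by apply: (cvg_dot dE cvg_id); apply: cvg_cst.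
Qed.

Lemma continuous_bigsum (K : numFieldType) (T : topologicalType)
    (V : normedModType K) (I : Type) (r : seq I) (f : I -> T -> V) :
  (forall i, continuous (f i)) -> continuous (fun x => \sum_(i <- r) f i x).
Proof.
move=> fc x; elim: r => [|i r IH].
  rewrite (_ : (fun _ => _) = fun=> 0); first exact: cvg_cst.
  by apply/funext => y; rewrite big_nil.
rewrite (_ : (fun _ => _) = (fun y => f i y + \sum_(j <- r) f j y)).
  exact: (cvgD (fc i x) IH).
by apply/funext => y; rewrite big_cons.
Qed.

Section states.
Variables (R : realType) (V : hilbertType R).
Local Open Scope complex_scope.

Lemma Re_dot_proj_ge0 (psi e : V) : 0 <= complex.Re (hdot V (proj_on psi e) e).
Proof.
rewrite /proj_on dotZl (dot_conj _ psi); have := mul_conjC_ge0 (hdot V e psi).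
by rewrite lecE /= => /andP[].
Qed.

Lemma real_complex_sqrtE (x : R) : 0 <= x ->
  x%:C = (Num.sqrt x)%:C * ((Num.sqrt x)%:C)^*%R.
Proof.
move=> x0; rewrite conj_Creal; last by rewrite ger0_real// lecR sqrtr_ge0.
by rewrite -rmorphM -expr2 sqr_sqrtr.
Qed.

(** Bessel's inequality on finite subsets of [E] gives one direction. For the other, totality gives
    a finite combination close to [psi], and the orthogonal residue of [psi] is no longer than the
    error. *)
Lemma parseval (E : set V) (psi : V) : orthonormal_basis E ->
  (\esum_(e in E) (complex.Re (hdot V (proj_on psi e) e))%:E =
   (complex.Re (hdot V psi psi))%:E)%E.
Proof.
move=> [E1 E0 Etot].
have projE e : hdot V (proj_on psi e) e = hdot V psi e * (hdot V psi e)^*%R.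
  by rewrite /proj_on dotZl (dot_conj _ e) mulrC.
have norm_ge0 (v : V) : 0 <= complex.Re (hdot V v v).
  by have := exprn_ge0 2 (normr_ge0 v); rewrite hnormE lecE => /andP[].
have res (s : seq V) : uniq s -> (forall e, e \in s -> E e) -> exists2 z : V,
    (forall e, e \in s -> hdot V z e = 0) &
    complex.Re (hdot V z z) = complex.Re (hdot V psi psi) -
       \sum_(e <- s) complex.Re (hdot V (proj_on psi e) e) /\
    exists a : V -> R[i], psi = z + \sum_(e <- s) a e *: e.
  move=> us sE.
  have [||zs zz] := @orthonormal_residue _ _ (hdot V) s psi us.
  - by move=> e /sE/E1.
  - by move=> e e' /sE Ee /sE Ee' ne; apply: E0.
  exists (psi - \sum_(e <- s) hdot V psi e *: e) => //; split; last first.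
    by exists (hdot V psi); rewrite subrK.
  rewrite zz raddfB raddf_sum; congr (_ - _).
  by apply: eq_bigr => e _; rewrite projE.
apply/eqP; rewrite eq_le; apply/andP; split.
  apply: ge_ereal_sup => _ [X [finX XE] <-].
  rewrite fsbig_finite//= sumEFin lee_fin.
  have [|z _ [zz _]] := res (finmap.enum_fset (fset_set X)) (finmap.fset_uniq _).
    by move=> e; rewrite in_fset_set// inE => /XE.
  by rewrite -subr_ge0 -zz.
apply/lee_addgt0Pr => eps eps0.
have : closure (linear_span E) psi by rewrite Etot.
move=> /closure_seq [w [Ew wpsi]].
(* An error below the square root of [eps] makes the squared norm at most [eps]. *)
have d0 : 0 < (Num.sqrt eps)%:C by rewrite ltcR sqrtr_gt0.
have /cvgrPdist_lt /(_ _ d0) [N _ /(_ N (leqnn N)) /= wN] := wpsi.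
have [m [a [e [Ee wE]]]] := Ew N.
set s := undup [seq e i | i <- enum 'I_m].
have sE x : x \in s -> E x by rewrite mem_undup => /mapP[i _ ->].
have [z zs [zz [b psiE]]] := res s (undup_uniq _) sE.
have le1 : complex.Re (hdot V z z) <= eps.
  have : complex.Re (hdot V (psi - w N) (psi - w N)) <= eps.
    have : `|psi - w N| ^+ 2 <= eps%:C.
      rewrite -[eps](sqr_sqrtr (ltW eps0)) rmorphXn /=.
      by rewrite lerXn2r ?nnegrE ?(ltW d0)// ltW// wN.
    by rewrite hnormE lecE => /andP[].
  apply: le_trans.
  (* [psi - w N] is [z] plus a combination of vectors of [s], all orthogonal to [z], so Pythagoras
     bounds [z]. *)
  rewrite psiE -addrA dot_normDd.
    by rewrite raddfD lerDl norm_ge0.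
  rewrite dotBr dot_sumr wE dot_sumr big_seq !big1 ?subr0// => [i _|x xs].
    by rewrite dotZr zs ?mulr0// mem_undup map_f// mem_enum.
  by rewrite dotZr zs// mulr0.
apply: (@le_trans _ _ ((\sum_(x <- s) complex.Re (hdot V (proj_on psi x) x))%:E + eps%:E)%E).
  by rewrite -EFinD lee_fin -lerBlDl -zz.
rewrite leeD2r// esum_ge//; exists [set` s]%classic.
  by split => [|x /=]; [exact: finite_seq|exact: sE].
by rewrite -fsbig_seq ?undup_uniq// sumEFin.
Qed.

(** [convex_on_states] only concerns states, so the partial mixtures in Jensen's inequality must be
    shown to be states. *)
Lemma mixture_is_state (m : nat) (p : 'I_m -> R) (psi : 'I_m -> V) :
  (forall i, 0 <= p i) -> \sum_i p i = 1 -> (forall i, unit_vector (psi i)) ->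
  mixed_state (fun v : V => \sum_(i < m) (p i)%:C *: proj_on (psi i) v).
Proof.
move=> p0 p1 psi1; split.
- move=> a u v; rewrite scaler_sumr -big_split; apply: eq_bigr => i _ /=.
  by rewrite /proj_on dotDl dotZl scalerDl !scalerDr !scalerA; congr (_ *: _ + _); ring.
- apply: continuous_bigsum => i x; apply: cvgZl_tmp.
  exact: (continuous_dotl_scale (@hnormE R V)).
- move=> v; rewrite dot_suml sumr_ge0// => i _.
  rewrite dotZl mulr_ge0 ?lecR// /proj_on dotZl (dot_conj _ (psi i)).
  exact: mul_conjC_ge0.
move=> E oE.
(* p |psi><psi| is the projection operator of sqrt p psi. *)
transitivity (\esum_(e in E) \sum_(i < m) (complex.Re (hdot V (proj_on ((Num.sqrt (p i))%:C *: psi i) e) e))%:E)%E.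
  apply: eq_esum => e _; rewrite dot_suml raddf_sum sumEFin; congr EFin.
  apply: eq_bigr => i _; congr complex.Re.
  rewrite /proj_on !dotZl dotZr (_ : (p i)%:C = (Num.sqrt (p i))%:C * ((Num.sqrt (p i))%:C)^*%R).
    ring.
  by rewrite -real_complex_sqrtE.
rewrite esum_sum; last by move=> e i _ _; rewrite lee_fin Re_dot_proj_ge0.
under eq_bigr do rewrite (parseval _ oE).
rewrite sumEFin -p1; congr EFin; apply: eq_bigr => i _.
by rewrite dotZl dotZr psi1 mulr1 -real_complex_sqrtE.
Qed.
End states.

Section jensen.
Variables (R : realType) (V : hilbertType R) (F : (V -> V) -> R).
Local Open Scope complex_scope.
Hypothesis F_convex : convex_on_states F.

Lemma proj_on_is_state (psi : V) : unit_vector psi -> mixed_state (proj_on psi).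
Proof.
move=> psi1.
have := @mixture_is_state R V 1 (fun=> 1) (fun=> psi) (fun=> ler01).
rewrite (_ : (fun v => _) = proj_on psi); last first.
  by apply/funext => v; rewrite big_ord1 scale1r.
by apply => //; rewrite big_ord1.
Qed.

Lemma jensen_states (m : nat) (p : 'I_m -> R) (psi : 'I_m -> V) :
  (forall i, 0 <= p i) -> \sum_i p i = 1 -> (forall i, unit_vector (psi i)) ->
  F (fun v => \sum_(i < m) (p i)%:C *: proj_on (psi i) v)
    <= \sum_i p i * F (proj_on (psi i)).
Proof.
elim: m p psi => [|m IH] p psi p0 p1 psi1.
  by move: p1; rewrite big_ord0 => /eqP; rewrite eq_sym oner_eq0.
rewrite [leRHS]big_ord_recl.
set t := p ord0; pose p' i := p (lift ord0 i).
have sump' : \sum_i p' i = 1 - t by rewrite -p1 big_ord_recl addrAC subrr add0r.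
have t1 : t <= 1 by rewrite -subr_ge0 -sump' sumr_ge0// => i _; exact: p0.
(* If [t = 1], the other weights vanish and cannot be rescaled; otherwise they are divided by
   [1 - t] to sum to [1]. *)
have [tE|tn1] := eqVneq t 1.
  have p'0 i : p' i = 0.
    by move: sump'; rewrite tE subrr => /psumr_eq0P; apply => // j _; exact: p0.
  rewrite (_ : (fun v => _) = proj_on (psi ord0)); last first.
    apply/funext => v; rewrite big_ord_recl -/t tE scale1r big1 ?addr0// => i _.
    by rewrite -/(p' i) p'0 scale0r.
  by rewrite tE mul1r big1 ?addr0// => i _; rewrite -/(p' i) p'0 mul0r.
have s0 : 0 < 1 - t by rewrite subr_gt0 lt_neqAle tn1.
pose q i := p' i / (1 - t).
have q0 i : 0 <= q i by rewrite divr_ge0// ?p0// ltW.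
have q1 : \sum_i q i = 1 by rewrite -mulr_suml sump' divff// gt_eqF.
have tq i : (1 - t) * q i = p' i by rewrite mulrC divfK// gt_eqF.
have psi1' i : unit_vector (psi (lift ord0 i)) by exact: psi1.
have t01 : 0 <= t <= 1 by rewrite p0.
have := F_convex t01 (proj_on_is_state (psi1 ord0)) (mixture_is_state q0 q1 psi1').
rewrite (_ : (fun v => _ + _) = (fun v => \sum_(i < m.+1) (p i)%:C *: proj_on (psi i) v)); last first.
  apply/funext => v; rewrite big_ord_recl scaler_sumr; congr (_ + _).
  by apply: eq_bigr => i _; rewrite scalerA -rmorphM tq.
move=> /le_trans; apply; rewrite lerD2l.
rewrite (le_trans (ler_wpM2l (ltW s0) (IH _ _ q0 q1 psi1')))// mulr_sumr.
by apply: ler_sum => i _; rewrite mulrA tq.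
Qed.
End jensen.

(** * Convex functions of block sizes *)

Section convex.
Variables (R : realType) (f : R -> R).
Hypothesis f_convex : @convex_function R R^o setT f.
Hypothesis f0 : f 0 = 0.

Lemma convex_functionE (t x y : R) : 0 <= t <= 1 ->
  f (t * x + (1 - t) * y) <= t * f x + (1 - t) * f y.
Proof.
move=> /andP[t0 t1].
by have := f_convex (Itv01 t0 t1) (in_setT x) (in_setT y); rewrite !convRE.
Qed.

(** If [x < y], then [a] and [b] are convex combinations of [x] and [y] with exchanged weights [t]
    and [1 - t], and the two convexity inequalities add up. *)
Lemma convex_spread (x y a b : R) : x <= a <= y -> a + b = x + y ->
  f a + f b <= f x + f y.
Proof.
move=> /andP[xa ay] ab; have bE : b = x + y - a by rewrite -ab addrAC subrr add0r.
have [xy|yx] := ltP x y; last first.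
  have ax : a = x by lra.
  have yE : y = x by lra.
  by rewrite bE ax yE addrK.
have d0 : 0 < y - x by rewrite subr_gt0.
pose t := (y - a) / (y - x).
have t01 : 0 <= t <= 1.
  rewrite divr_ge0 ?(ltW d0) ?subr_ge0//= ler_pdivrMr// mul1r; lra.
have t01' : 0 <= 1 - t <= 1 by lra.
have tE : t * (y - x) = y - a by rewrite divfK// gt_eqF.
have aE : a = t * x + (1 - t) * y by lra.
have bE' : b = (1 - t) * x + (1 - (1 - t)) * y by lra.
have := convex_functionE x y t01; have := convex_functionE x y t01'.
rewrite -aE -bE'; lra.
Qed.

(* The sum of the f (r_j) for n systems grouped into blocks of size k and one
   smaller block. *)
Definition packed (k n : nat) : R := (n %/ k)%:R * f k%:R + f (n - n %/ k * k)%:R.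

(** The new block joins the remainder [s] of [n]. If [s + r < k], the pair [s], [r] is spread to
    [0], [s + r], where [f 0 = 0]; otherwise to [s + r - k], [k], which completes one more full
    block. *)
Lemma packed_add (k n r : nat) : (0 < k)%N -> (r <= k)%N ->
  packed k n + f r%:R <= packed k (n + r).
Proof.
move=> k0 rk; rewrite /packed.
set q := (n %/ k)%N; set s := (n - q * k)%N.
have nE : n = (q * k + s)%N by rewrite subnKC// leq_trunc_div.
have sk : (s < k)%N by have := ltn_ceil n k0; rewrite -/q; lia.
have [lt|ge] := ltnP (s + r) k.
  have -> : ((n + r) %/ k = q)%N by rewrite nE -addnA divnMDl// divn_small// addn0.
  have -> : (n + r - q * k = s + r)%N by lia.
  have := @convex_spread 0 (s + r)%:R s%:R r%:R.
  rewrite ler0n ler_nat leq_addr natrD add0r f0 => /(_ isT erefl); lra.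
have -> : ((n + r) %/ k = q.+1)%N.
  rewrite (_ : n + r = q.+1 * k + (s + r - k))%N; last lia.
  by rewrite divnMDl// divn_small ?addn0//; lia.
have -> : (n + r - q.+1 * k = s + r - k)%N by lia.
have := @convex_spread (s + r - k)%:R k%:R s%:R r%:R.
rewrite !ler_nat -!natrD subnK// => /(_ _ erefl) h.
have : f s%:R + f r%:R <= f (s + r - k)%:R + f k%:R by apply: h; lia.
rewrite -natr1; lra.
Qed.

Lemma sum_packed (k l : nat) (r : 'I_l -> nat) : (0 < k)%N ->
  (forall j, (r j <= k)%N) ->
  \sum_j f (r j)%:R <= packed k (\sum_j r j).
Proof.
move=> k0; elim: l r => [|l IH] r rk.
  by rewrite !big_ord0 /packed div0n mul0r add0r f0.
rewrite !big_ord_recr /=; apply: le_trans (packed_add _ _ _) => //.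
by rewrite lerD2r; apply: IH.
Qed.

(** Convexity between [0] and [k] with [f 0 = 0] bounds the value of [f] at the remainder [s] by
    [s / k] times its value at [k], and [n / k = q + s / k]. *)
Lemma packed_le (k n : nat) : (0 < k)%N -> packed k n <= n%:R / k%:R * f k%:R.
Proof.
move=> k0; rewrite /packed; set q := (n %/ k)%N; set s := (n - q * k)%N.
have nE : n = (q * k + s)%N by rewrite subnKC// leq_trunc_div.
have sk : (s < k)%N by have := ltn_ceil n k0; rewrite -/q; lia.
have kR : k%:R != 0 :> R by rewrite pnatr_eq0 -lt0n.
have := @convex_functionE (s%:R / k%:R) k%:R 0.
rewrite f0 !mulr0 !addr0 divfK// => h.
rewrite [in leRHS]nE natrD natrM mulrDl mulfK// mulrDl lerD2l h//.
by rewrite divr_ge0//= ler_pdivrMr ?ltr0n// mul1r ler_nat ltnW.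
Qed.
End convex.

(** * The bound for separable states *)

Theorem mainTheorem11 (R : realType) (H : hilbertType R)
    (T : forall n : nat, tensor_power H n)
    (F : forall n : nat, (T n -> T n) -> R) (f : R -> R)
    (Gam : forall n : nat, set (T n -> T n))
    (F_convex : forall n : nat, (0 < n)%N -> convex_on_states (F n))
    (F_subadd : subadditive_on_pure_products F)
    (f_convex : @convex_function R R^o setT f)
    (f0 : f 0 = 0)
    (Gam_state : forall n : nat, (0 < n)%N -> Gam n `<=` @mixed_state R (T n))
    (F_Gam : forall (n : nat) (rho : T n -> T n), (0 < n)%N -> Gam n rho ->
       F n rho <= f n%:R)
    (k n : nat) (k_gt0 : (1 <= k)%N) (k_le_n : (k <= n)%N)
    (rho : T n -> T n) (rho_state : mixed_state rho)
    (rho_sep : k_separable Gam k rho) :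
  F n rho <= (n %/ k)%:R * f k%:R + f (n - n %/ k * k)%:R /\
  (n %/ k)%:R * f k%:R + f (n - n %/ k * k)%:R <= n%:R / k%:R * f k%:R.
Proof.
split; last exact: packed_le.
have n0 : (0 < n)%N by exact: leq_trans k_le_n.
have [m [p [psi [p0 p1 psi_sep ->]]]] := rho_sep.
have pure i : F n (proj_on (psi i)) <= packed f k n.
  (* With no group at all, the system [Ordinal n0] would lie in none, so there is at least one
     group. *)
  have [_ [[|l] [r [e [phi [ge prod H0]]]]]] := psi_sep i.
    by have [[h _ _] _] := ge; case: (h (Ordinal n0)) => -[].
  have rn : n = \sum_j r j.
    have := bij_eq_card ge.1; rewrite card_tagged card_ord => <-.
    by rewrite sumnE big_map big_enum; apply: eq_bigr => j _; rewrite card_ord.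
  apply: (@le_trans _ _ (\sum_j f (r j)%:R)).
    apply: le_trans (subadditive_product F_subadd _ ge _ prod) _.
    - by move=> j; have [] := H0 j.
    - by move=> j; have [] := H0 j.
    by apply: ler_sum => j _; have [r0 _ _ G] := H0 j; exact: F_Gam.
  by rewrite [in leRHS]rn sum_packed// => j; have [] := H0 j.
apply: le_trans (jensen_states (F_convex n n0) p0 p1 _) _.
  by move=> i; have [] := psi_sep i.
(* As the weights sum to [1], the common bound for the pure states equals its weighted average. *)
rewrite -/(packed f k n) -[leRHS]mul1r -p1 mulr_suml.
by apply: ler_sum => i _; exact: ler_wpM2l.
Qed.
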